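(* Let $S\subset\mathbb{R}^2$ be a nonempty and closed set satisfying the interior $r$-sphere condition for some $r>0$. Then $S$ is the union of closed balls with common radius $\frac{r}{\sqrt{3}}$; that is, every point of $S$ belongs to some closed ball of radius $\frac{r}{\sqrt{3}}$ that is contained in $S$.
   Context: $\mathbb{R}^n$ carries the Euclidean norm $\|\cdot\|$. For $x\in\mathbb{R}^n$ and $\rho>0$, $\overline{B}(x;\rho)$ denotes the closed ball of center $x$ and radius $\rho$. A nonempty and closed set $S\subset\mathbb{R}^n$ satisfies the interior $r$-sphere condition ($r>0$) if for every boundary point $s$ of $S$ there exists a closed ball of radius $r$ contained in $S$ whose boundary contains $s$; equivalently, for every $s\in\mathrm{bdry}\,S$ there exists $x\in S$ such that $s\in\overline{B}(x;r)\subset S$. *)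

(* Defs.v *)
From mathcomp Require Import all_boot all_order all_algebra.
From mathcomp Require Import all_classical all_reals topology normedtype.

Set Implicit Arguments.
Unset Strict Implicit.
Unset Printing Implicit Defensive.

Import Order.TTheory GRing.Theory Num.Theory.
Import numFieldNormedType.Exports.
Local Open Scope classical_set_scope.
Local Open Scope ring_scope.

(* R^n is 'rV[R]_n. The library norm `|x| on 'rV[R]_n is the sup norm, hence
   the Euclidean norm below; both norms induce the library's topology, so
   closed, closure and interior have their usual meaning. *)
Definition enorm (R : realType) (n : nat) (x : 'rV[R]_n) : R :=
  Num.sqrt (\sum_(i < n) x ord0 i ^+ 2).

Definition closed_eball (R : realType) (n : nat) (x : 'rV[R]_n) (rho : R) :
    set 'rV[R]_n :=
  [set y | enorm (y - x) <= rho].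

Definition bdry (T : topologicalType) (A : set T) : set T :=
  closure A `\` interior A.

Definition interior_sphere_condition (R : realType) (n : nat) (r : R)
    (S : set 'rV[R]_n) : Prop :=
  forall s, bdry S s ->
    exists x, closed_eball x r `<=` S /\ bdry (closed_eball x r) s.

(* Main.v *)
(* Let [d = r / sqrt 3].  Consider a disk of radius [R < d] contained in [S] and
   a point [p] of its boundary circle that is also on the boundary of [S].
   Walking from points outside [S] near [p] in any direction [e] pointing into
   the disk, one enters [S] at boundary points near [p]; the limit of the
   [r]-disks given there is an [r]-disk of [S] touching [p] whose center lies
   on the side of [e].  Such a disk contains no other contact point in its
   interior, and a good choice of [e] shows that two other contact points are
   seen from [p] under an angle less than 60 degrees.  As the angles of a
   triangle add up to 180 degrees, there are at most two contact points.

   Now let [s] be in [S] and grow a disk inside [S], always keeping [s]: first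
   concentrically around [s] until there is a contact point [p], then tangentially
   at [p] until there is a second one [q], then in the pencil of circles through
   [p] and [q], moving the center to the side of [s]. A third contact point is
   impossible and a tangential obstruction at an old contact point forces the
   inner tangent [r]-disk to lie in [S], so the radius reaches [d]. *)

Require Import Defs.
From mathcomp Require Import all_boot all_order all_algebra.
From mathcomp Require Import all_classical all_reals topology normedtype.
From mathcomp Require Import interval_inference ring lra.

Import Order.TTheory GRing.Theory Num.Theory.
Import numFieldNormedType.Exports.
Local Open Scope classical_set_scope.
Local Open Scope ring_scope.

Section InteriorSphere.
Context {R : realType}.
Implicit Types (c e m n p q s u v w x y z : 'rV[R]_2) (S : set 'rV[R]_2) (a b d r t : R).

(** * Scalar product and quarter turn in the plane *)

Definition dot u v : R :=
  u ord0 ord0 * v ord0 ord0 + u ord0 ord_max * v ord0 ord_max.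

Definition perp u : 'rV[R]_2 :=
  \row_i (if i == ord0 then - u ord0 ord_max else u ord0 ord0).

Lemma dotC u v : dot u v = dot v u.
Proof. by rewrite /dot; ring. Qed.
Lemma dotDl u v w : dot (u + v) w = dot u w + dot v w.
Proof. by rewrite /dot !mxE; ring. Qed.
Lemma dot0l w : dot 0 w = 0.
Proof. by rewrite /dot !mxE; ring. Qed.
Lemma dotNl u w : dot (- u) w = - dot u w.
Proof. by rewrite /dot !mxE; ring. Qed.
Lemma dotZl (k : R) u w : dot (k *: u) w = k * dot u w.
Proof. by rewrite /dot !mxE; ring. Qed.
Lemma dotDr u v w : dot w (u + v) = dot w u + dot w v.
Proof. by rewrite /dot !mxE; ring. Qed.
Lemma dotNr u w : dot w (- u) = - dot w u.
Proof. by rewrite /dot !mxE; ring. Qed.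
Lemma dotZr (k : R) u w : dot w (k *: u) = k * dot w u.
Proof. by rewrite /dot !mxE; ring. Qed.
Lemma dot_perp u : dot u (perp u) = 0.
Proof. by rewrite /dot !mxE /=; ring. Qed.
Lemma dot_perp_perp u v : dot (perp u) (perp v) = dot u v.
Proof. by rewrite /dot !mxE /=; ring. Qed.

Lemma dot_subsub u v : dot (u - v) (u - v) = dot u u - 2 * dot u v + dot v v.
Proof. by rewrite /dot !mxE; ring. Qed.

Definition dotE := (dotDl, dotDr, dotNl, dotNr, dotZl, dotZr).

Lemma dot_ge0 u : 0 <= dot u u.
Proof. by rewrite /dot -!expr2 addr_ge0 ?sqr_ge0. Qed.

Lemma dot_eq0 u : dot u u = 0 -> u = 0.
Proof.
rewrite /dot -!expr2 => /eqP; rewrite paddr_eq0 ?sqr_ge0// !sqrf_eq0.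
move=> /andP[/eqP h0 /eqP h1]; apply/rowP => i; rewrite mxE.
by case: i => -[|[|//]] hi; [rewrite -h0|rewrite -h1]; congr (u _ _); exact/val_inj.
Qed.

Lemma dot_gt0 u v : u != v -> 0 < dot (u - v) (u - v).
Proof.
move=> uv; rewrite lt_neqAle dot_ge0 andbT eq_sym; apply: contra uv => /eqP/dot_eq0/eqP.
by rewrite subr_eq0.
Qed.

Lemma cauchy_schwarz u v : dot u v ^+ 2 <= dot u u * dot v v.
Proof.
have : 0 <= (u ord0 ord0 * v ord0 ord_max - u ord0 ord_max * v ord0 ord0) ^+ 2 by exact: sqr_ge0.
by rewrite /dot; nra.
Qed.

(** [m] and [perp m] are orthogonal and both of squared length [dot m m]: Parseval's identity in an
    unnormalized frame. *)
Lemma dot_frame m u v :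
  dot m m * dot u v = dot u m * dot v m + dot u (perp m) * dot v (perp m).
Proof. by rewrite /dot !mxE /=; ring. Qed.

(** * Continuity, the Euclidean norm and compactness *)

Lemma continuous_coord (i : 'I_2) c : continuous (fun z : 'rV[R]_2 => (z - c) ord0 i).
Proof.
have -> : (fun z : 'rV[R]_2 => (z - c) ord0 i) = (fun z => z ord0 i - c ord0 i).
  by apply/funext => z; rewrite !mxE.
by move=> z; apply: continuousB; [exact: coord_continuous|exact: cst_continuous].
Qed.

Lemma continuous_dot u c : continuous (fun z => dot u (z - c)).
Proof.
move=> z; have h i := @continuous_coord i c z.
exact: (cvgD (cvgM (cvg_cst _) (h ord0)) (cvgM (cvg_cst _) (h ord_max))).
Qed.

Lemma continuous_normsq c : continuous (fun z => dot (z - c) (z - c)).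
Proof.
move=> z; have h i := @continuous_coord i c z.
exact: (cvgD (cvgM (h ord0) (h ord0)) (cvgM (h ord_max) (h ord_max))).
Qed.

Lemma enorm_le u (a : R) : 0 <= a -> (enorm u <= a) = (dot u u <= a ^+ 2).
Proof.
move=> a0; have -> : dot u u = \sum_(i < 2) u ord0 i ^+ 2.
  rewrite !big_ord_recl big_ord0 addr0 /dot -!expr2; congr (_ + u _ _ ^+ 2); exact/val_inj.
by rewrite /enorm -{1}(ger0_norm a0) -sqrtr_sqr ler_sqrt // sqr_ge0.
Qed.

Lemma cts_nbhs_lt (f : 'rV[R]_2 -> R) (a : R) z :
  continuous f -> f z < a -> nbhs z [set x | f x < a].
Proof. by move=> cf h; exact: (cf z _ (lt_nbhsl h)). Qed.

Lemma cts_nbhs_gt (f : 'rV[R]_2 -> R) (a : R) z :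
  continuous f -> a < f z -> nbhs z [set x | a < f x].
Proof. by move=> cf h; exact: (cf z _ (lt_nbhsr h)). Qed.

(** Bolzano-Weierstrass for points satisfying [P] at 1/(i+1); monotonicity in [d] extends the
    property of the cluster point to every [d]. *)
Lemma accumulation_point (P : R -> set 'rV[R]_2) (M : R) :
    (forall d d', d <= d' -> P d `<=` P d') ->
    (forall d, 0 < d -> exists z, dot z z <= M /\ P d z) ->
  exists q, forall U, nbhs q U -> forall d, 0 < d -> exists z, U z /\ P d z.
Proof.
move=> mono ex.
pose K := [set z : 'rV[R]_2 | dot z z <= M].
have cK : compact K.
  apply: bounded_closed_compact.
    exists (M + 1); split; first exact: num_real.
    move=> x Mx z Kz; have hz : dot z z <= M by [].
    have x1 : M + 1 < x by [].
    have hc (i : 'I_2) : z ord0 i ^+ 2 <= dot z z.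
      rewrite /dot -!expr2; case: i => -[|[|//]] hi.
        by rewrite (_ : Ordinal hi = ord0) ?lerDl ?sqr_ge0//; exact/val_inj.
      by rewrite (_ : Ordinal hi = ord_max) ?lerDr ?sqr_ge0//; exact/val_inj.
    have M0 : 0 <= M by apply: le_trans hz; exact: dot_ge0.
    rewrite /= [`|z|]mx_normrE; apply: bigmax_le; first by lra.
    move=> [i j] _ /=; rewrite (ord1 i).
    rewrite -(ler_pXn2r (n := 2)) ?nnegrE ?normr_ge0//; last by lra.
    rewrite -normrX ger0_norm ?sqr_ge0//; apply: (le_trans (hc j)); nra.
  rewrite (_ : K = (fun z => dot (z - 0) (z - 0)) @^-1` [set x | x <= M]).
    by apply: preimage_closed => [z _|]; [exact: continuous_normsq|exact: closed_le].
  by apply/seteqP; split => z; rewrite /K /= subr0.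
have inv (i : nat) : 0 < (i.+1%:R : R)^-1 by rewrite invr_gt0 ltr0n.
have [u hu] := choice (fun i => ex _ (inv i)).
have [q [_ clq]] : K `&` cluster (u @ \oo) !=set0.
  by apply: cK; exists 0%N => // i _; exact: (hu i).1.
exists q => U Uq d d0.
have [N _ hN] : \forall n \near \oo, (n.+1%:R : R)^-1 < d.
  exact: near_infty_natSinv_lt (PosNum d0).
have hP : (u @ \oo) (P d).
  by exists N => // n Nn; apply: mono (hu n).2; rewrite ltW//; exact: hN.
have [z [Pz Uz]] := clq _ _ hP Uq; exists z; split; [exact: Uz|exact: Pz].
Qed.

(** * Open disks contained in a closed set *)

(* [t] is the squared radius. *)
Definition odisk c t : set 'rV[R]_2 := [set z | dot (z - c) (z - c) < t].

Lemma odisk_nbhs c t z : odisk c t z -> nbhs z (odisk c t).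
Proof. by move=> h; apply: cts_nbhs_lt => //; exact: continuous_normsq. Qed.

Lemma odisk_closure S c t p :
  odisk c t `<=` S -> closure (~` S) p -> t <= dot (p - c) (p - c).
Proof.
move=> sub cp; rewrite leNgt; apply/negP => /odisk_nbhs /cp [z [Sz zd]].
exact/Sz/sub.
Qed.

Lemma dotNN u : dot (- u) (- u) = dot u u.
Proof. by rewrite dotNl dotNr opprK. Qed.

(** Read as a condition on the vector [w] to the center, membership is again an open disk; so
    inclusions of disks pass to limits of their centers. *)
Lemma odisk_translate p w t z : odisk (p + w) t z = odisk (z - p) t w.
Proof.
rewrite /odisk /= -[in RHS]dotNN; congr (dot _ _ < _ : Prop);
  by apply/rowP => i; rewrite !mxE; ring.
Qed.

Lemma nbhs_line z v (U : set 'rV[R]_2) : nbhs z U ->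
  exists d : R, 0 < d /\ forall t, 0 <= t <= d -> U (z + t *: v).
Proof.
move=> /nbhs_ballP[e /= e0 sub].
have n0 := normr_ge0 v.
have n1 : 0 < 1 + `|v| by lra.
exists (e / (1 + `|v|) / 2); split; first by rewrite !divr_gt0.
move=> t /andP[t0 te]; apply: sub; rewrite -ball_normE /= opprD addrA subrr sub0r normrN.
rewrite normrZ ger0_norm//.
have : t * 2 <= e / (1 + `|v|) by lra.
by rewrite ler_pdivlMr//; nra.
Qed.

Lemma odisk_sub_closed S c t z : closed S -> 0 < t -> odisk c t `<=` S ->
  dot (z - c) (z - c) <= t -> S z.
Proof.
move=> cS t0 sub zt; apply: contrapT => Sz.
have oS : nbhs z (~` S) by apply: open_nbhs_nbhs; split => //; exact: closed_openC.
have [d [d0 hd]] := nbhs_line _ (c - z) _ oS.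
pose k := Num.min d 1.
have k0 : 0 < k by rewrite lt_min d0 ltr01.
have kd : k <= d by rewrite ge_min lexx.
have k1 : k <= 1 by rewrite ge_min lexx orbT.
apply: (hd k); first by rewrite ltW.
apply: sub; rewrite /odisk /=.
have -> : z + k *: (c - z) - c = (1 - k) *: (z - c).
  by apply/rowP => i; rewrite !mxE; ring.
rewrite dotZl dotZr; have := dot_ge0 (z - c); move: zt; set D := dot _ _ => zt D0.
have : 0 <= (1 - k) ^+ 2 * (t - D) by rewrite mulr_ge0 ?sqr_ge0 ?subr_ge0.
have : 0 < k * (2 - k) * t by rewrite !mulr_gt0//; lra.
by nra.
Qed.

(** * Supporting disks at contact points *)

Lemma small_factor (a b : R) : 0 < a -> 0 <= b -> exists k : R, [/\ 0 < k, k <= 1 & k * b <= a].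
Proof.
move=> a0 b0; have ab : 0 < a / (a + b) by rewrite divr_gt0//; lra.
exists (a / (a + b)); split=> //; first by rewrite ler_pdivrMr; lra.
by rewrite mulrAC ler_pdivrMr; nra.
Qed.

Lemma sqr_bound (a b : R) : 0 <= b -> a ^+ 2 <= b ^+ 2 -> a <= b.
Proof. by move=> b0 ab; nra. Qed.

(** An upper bound on the distance suffices: as [q] is adherent to the complement, [odisk_closure]
    supplies the reverse inequality. *)
Definition disk_condition r S := forall q, S q -> closure (~` S) q ->
  exists y, dot (y - q) (y - q) <= r ^+ 2 /\ odisk y (r ^+ 2) `<=` S.

(** A walk starts outside an open [r]-disk and ends in its closure, so [e] has an almost nonnegative
    product with the vector from the end point to the center, with an error of the order of the
    walk. As the walks shrink to [p], the error vanishes. *)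
Lemma supporting_disk S r c p e :
    closed S -> 0 < r -> disk_condition r S ->
    closure (~` S) p -> odisk c (dot (p - c) (p - c)) `<=` S ->
    0 < dot e (c - p) ->
  exists w, [/\ dot w w = r ^+ 2, odisk (p + w) (r ^+ 2) `<=` S & 0 <= dot e w].
Proof.
move=> cS r0 sph cp sub ecp.
(* Centers that satisfy the conclusion up to [d]. The bound [r ^+ 2 + 1] is independent of [d] and
   gives compactness. *)
pose P (d : R) := [set y | [/\ odisk y (r ^+ 2) `<=` S,
  dot (y - p) (y - p) <= r ^+ 2 + d, dot (y - p) (y - p) <= r ^+ 2 + 1 & - d <= dot e (y - p)]].
have ee := dot_ge0 e.
have key d : 0 < d -> exists y, P d y.
  move=> d0.
  (* [K] will bound the distance from [p] to the entry point; all errors below are at most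
     [K * (2 * r + 2 + dot e e)]. *)
  have [K [K0 K1 Kd]] := small_factor (Num.min d 1) (2 * r + 2 + dot e e)
    ltac:(by rewrite lt_min d0 ltr01) ltac:(lra).
  have {Kd} [Kd Kone] : K * (2 * r + 2 + dot e e) <= d /\ K * (2 * r + 2 + dot e e) <= 1.
    by split; apply: (le_trans Kd); rewrite ge_min lexx ?orbT.
  have [T [T0 _ Te]] := small_factor (Num.min (K / 2) (dot e (c - p))) (1 + dot e e)
    ltac:(by rewrite lt_min ecp andbT; lra) ltac:(lra).
  have {Te} [TK Tc] : T * (1 + dot e e) <= K / 2 /\ T * (1 + dot e e) <= dot e (c - p).
    by split; apply: (le_trans Te); rewrite ge_min lexx ?orbT.
  (* The disk moved by [- T *: e] has [p] in its interior, so [T *: e] carries every point near [p]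
     into [S]. *)
  have Up : nbhs p (odisk (c - T *: e) (dot (p - c) (p - c))).
    apply: odisk_nbhs; rewrite /odisk /= opprB addrCA addrC.
    have -> : dot (p - c + T *: e) (p - c + T *: e) =
        dot (p - c) (p - c) + T * (T * dot e e - 2 * dot e (c - p)).
      by rewrite /dot !mxE; ring.
    by nra.
  have Up' : nbhs p (odisk p (K ^+ 2 / 4)).
    by apply: odisk_nbhs; rewrite /odisk /= subrr dot0l; nra.
  have [q [Sq [qc qp]]] := cp _ (filterI Up Up').
  have ST : S (q + T *: e).
    apply: sub; move: qc; rewrite /odisk /=; congr (dot _ _ < _);
    by apply/rowP => i; rewrite !mxE; ring.
  (* The walk from [q] in direction [e] enters [S] at time [inf A]. *)
  pose A := [set s : R | 0 <= s /\ S (q + s *: e)].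
  have AT : A T by split => //; exact: ltW.
  have infA : has_inf A by split; [exists T|exists 0 => s []].
  pose s := inf A.
  have s0 : 0 <= s by apply: lb_le_inf; [exists T|move=> x []].
  have sT : s <= T by apply: ge_inf => //; case: infA.
  have Ss : S (q + s *: e).
    apply: contrapT => nS.
    have oS : nbhs (q + s *: e) (~` S) by apply: open_nbhs_nbhs; split => //; exact: closed_openC.
    have [h [h0 hh]] := nbhs_line _ e _ oS.
    have [a [a0 Sa] ah] := inf_adherent h0 infA.
    have sa : s <= a by apply: ge_inf => //; case: infA.
    apply: (hh (a - s)); first by rewrite subr_ge0 sa /=; rewrite -/s in ah; lra.
    by rewrite -addrA -scalerDl addrCA subrr addr0.
  have s_gt0 : 0 < s.
    rewrite lt_neqAle s0 andbT; apply/eqP => s00.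
    by apply: Sq; move: Ss; rewrite -s00 scale0r addr0.
  have cs : closure (~` S) (q + s *: e).
    move=> U /(nbhs_line _ (- e))[h [h0 hh]].
    pose k := Num.min h s.
    have k0 : 0 < k by rewrite lt_min h0 s_gt0.
    have kh : k <= h by rewrite ge_min lexx.
    have ks : k <= s by rewrite ge_min lexx orbT.
    exists (q + s *: e + k *: - e); split; last by apply: hh; rewrite ltW.
    rewrite scalerN -addrA -scalerBl => Sk.
    have : s <= s - k by apply: ge_inf; [case: infA|split => //; lra].
    by lra.
  have [y [yz yS]] := sph _ Ss cs.
  have qy : r ^+ 2 <= dot (q - y) (q - y).
    by rewrite leNgt; apply/negP => /yS.
  exists y.
  pose a := y - (q + s *: e); pose b := q - p.
  have ypE : y - p = a + (b + s *: e).
    by apply/rowP => i; rewrite !mxE; ring.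
  have qyE : q - y = - (a + s *: e).
    by apply/rowP => i; rewrite !mxE; ring.
  have aa : dot a a <= r ^+ 2 by move: yz; rewrite /a -opprB dotNN.
  have bK : dot b b < K ^+ 2 / 4 by exact: qp.
  clearbody a b.
  have gK : dot (b + s *: e) (b + s *: e) <= K ^+ 2.
    have : dot (b + s *: e) (b + s *: e) <= 2 * dot b b + 2 * (s * s * dot e e).
      have := dot_ge0 (b - s *: e); rewrite !dotE (dotC e b); lra.
    have sE : s * (1 + dot e e) <= K / 2 by nra.
    have : s * s * dot e e <= (s * (1 + dot e e)) ^+ 2 by nra.
    have : (s * (1 + dot e e)) ^+ 2 <= (K / 2) ^+ 2 by rewrite lerXn2r ?nnegrE//; nra.
    by lra.
  have ag : dot a (b + s *: e) <= r * K.
    apply: sqr_bound; first by nra.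
    apply: (le_trans (cauchy_schwarz _ _)); rewrite exprMn.
    by apply: ler_pM => //; exact: dot_ge0.
  have eg : - ((1 + dot e e) * K) <= dot e (b + s *: e).
    rewrite lerNl -dotNr; apply: sqr_bound; first by nra.
    apply: (le_trans (cauchy_schwarz _ _)); rewrite exprMn dotNl dotNr opprK.
    by apply: ler_pM => //; [exact: dot_ge0|nra].
  (* [q] is no nearer to the center than the entry point; the difference of the squared distances is
     divided by [s > 0]. *)
  have ae : - (s * dot e e) <= 2 * dot e a.
    have : 0 <= s * (2 * dot e a + s * dot e e).
      by move: qy; rewrite qyE dotNN !dotE (dotC a e); lra.
    by rewrite pmulr_rge0//; lra.
  have see : s * dot e e <= K / 2 by nra.
  have nyp : dot (y - p) (y - p) <= r ^+ 2 + K * (2 * r + 1).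
    rewrite ypE dotDl (dotDr a) (dotDr a) (dotC _ a).
    by nra.
  split => //.
  - by nra.
  - by nra.
  - by rewrite ypE dotDr; nra.
have [y hy] : exists q, forall U, nbhs q U -> forall d, 0 < d -> exists z, U z /\ P d (z + p).
  apply: (accumulation_point (fun d => [set z | P d (z + p)]) (r ^+ 2 + 1)) =>
    [d d' dd z [] h1 h2 h3 h4|d /key[y [h1 h2 h3 h4]]].
    by split=> //; lra.
  exists (y - p); split=> //=; by rewrite subrK.
have yS : odisk (p + y) (r ^+ 2) `<=` S.
  move=> z; rewrite odisk_translate => /odisk_nbhs hU.
  have [x [xy [xS _ _ _]]] := hy _ hU 1 ltr01.
  by apply: xS; rewrite addrC odisk_translate.
exists y; split => //.
- apply/eqP; rewrite eq_le; apply/andP; split; last first.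
    have := odisk_closure _ _ _ _ yS cp.
    by rewrite opprD addNKr dotNN.
  rewrite leNgt; apply/negP => h.
  have hU : nbhs y [set x | r ^+ 2 + (dot y y - r ^+ 2) / 2 < dot (x - 0) (x - 0)].
    by apply: cts_nbhs_gt; [exact: continuous_normsq|rewrite subr0; lra].
  have [x [/= + [_ + _ _]]] := hy _ hU ((dot y y - r ^+ 2) / 2) ltac:(lra).
  by rewrite addrK subr0; lra.
- rewrite leNgt; apply/negP => h.
  have hU : nbhs y [set x | dot e (x - 0) < dot e y / 2].
    by apply: cts_nbhs_lt; [exact: continuous_dot|rewrite subr0; lra].
  have [x [/= + [_ _ _ +]]] := hy _ hU (- dot e y / 2) ltac:(lra).
  by rewrite addrK subr0; lra.
Qed.

(** * Angles between contact points on a circle *)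

(* The tangent of the oriented angle from [c - p] to [q - p]; when [q] is on the
   circle of center [c] through [p], the cotangent of half the arc [pq]. *)
Definition slope c p q : R :=
  2 * dot (q - p) (perp (c - p)) / dot (q - p) (q - p).

Lemma slopeC c p q : slope c q p = - slope c p q.
Proof.
rewrite /slope -(opprB q p) dotNN -mulNr; congr (_ / _).
by rewrite /dot !mxE /=; ring.
Qed.

(** In the plane of [X, Y] the three half-planes bound a triangle. If the conclusion failed, its
    vertices, and hence all its points, would have squared norm at most [3 * Q ^+ 2], against
    [Q * s > 3 * Q ^+ 2]. *)
Lemma wedge_bound (X Y Q s T1 T2 : R) :
    0 < Q -> 3 * Q < s -> X ^+ 2 + Y ^+ 2 = Q * s ->
    X + T1 * Y <= Q -> X + T2 * Y <= Q -> 0 <= X + (T1 + T2) / 2 * Y ->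
  3 * (T1 - T2) ^+ 2 < 4 + (T1 + T2) ^+ 2.
Proof.
move=> Q0 Qs XY h1 h2 h3; rewrite ltNge; apply/negP => hT.
pose D := (T1 + T2) / 2; pose M := (T1 - T2) / 2; pose g := X + D * Y; pose h := Q - g.
have hM : 1 + D ^+ 2 <= 3 * M ^+ 2 by rewrite /D /M; lra.
have g0 : 0 <= g by [].
have hp : M * Y <= h by rewrite /h /g /D /M; lra.
have hn : - h <= M * Y by rewrite /h /g /D /M; lra.
have XE : X = g - D * Y by rewrite /g; ring.
have QE : Q = g + h by rewrite /h; ring.
have h0 : 0 <= h by lra.
clearbody D M g h.
have MY : (M * Y) ^+ 2 <= h ^+ 2 by nra.
have DY : (1 + D ^+ 2) * Y ^+ 2 <= 3 * h ^+ 2.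
  by have := ler_wpM2r (sqr_ge0 Y) hM; nra.
have DY2 : - (D * Y) <= 2 * h.
  apply: sqr_bound; first by lra.
  by rewrite sqrrN; have := sqr_ge0 Y; nra.
have : X ^+ 2 + Y ^+ 2 <= 3 * Q ^+ 2.
  have := ler_wpM2l g0 DY2; rewrite XE QE; nra.
by rewrite XY; nra.
Qed.

Lemma angle_bound c p q q' (s : R) :
    3 * dot (p - c) (p - c) < s -> p != c -> q != p -> q' != p ->
    dot (q - c) (q - c) = dot (p - c) (p - c) ->
    dot (q' - c) (q' - c) = dot (p - c) (p - c) ->
    (forall e, 0 < dot e (c - p) -> exists w, [/\ dot w w = s, 0 <= dot e w,
       s <= dot (q - (p + w)) (q - (p + w)) & s <= dot (q' - (p + w)) (q' - (p + w))]) ->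
  3 * (slope c p q - slope c p q') ^+ 2 < 4 + (slope c p q + slope c p q') ^+ 2.
Proof.
move=> ps pc qp qp' hq hq' supp.
pose m := c - p; pose T1 := slope c p q; pose T2 := slope c p q'.
have mm : dot m m = dot (p - c) (p - c) by rewrite -dotNN opprB.
have m0 : 0 < dot m m by rewrite mm dot_gt0.
(* The bound [2 * dot d w <= dot d d = 2 * dot d m], expanded in the frame [m], [perp m] and divided
   by [dot d m > 0]. *)
have frame x w : x != p -> dot (x - c) (x - c) = dot (p - c) (p - c) ->
    s <= dot (x - (p + w)) (x - (p + w)) -> dot w w = s ->
    dot w m + slope c p x * dot w (perp m) <= dot m m.
  move=> xp hx hs ws; pose d := x - p.
  have d0 : 0 < dot d d by rewrite dot_gt0.
  have dm : 2 * dot d m = dot d d.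
    by move: hx; rewrite /d /m /dot !mxE; lra.
  have dw : 2 * dot d w <= dot d d.
    by move: hs; rewrite -ws /d /dot !mxE; lra.
  have sd : slope c p x * dot d d = 2 * dot d (perp m) by rewrite /slope divfK ?gt_eqF.
  rewrite -(ler_pM2r d0) mulrDl mulrAC sd -dm.
  have k := ler_wpM2l (ltW m0) dw; rewrite -dm in k.
  by have := dot_frame m d w; lra.
(* For this direction, [0 <= dot e w] bounds below the average of the left-hand
   sides of the two [frame] constraints. *)
have em : 0 < dot (m + ((T1 + T2) / 2) *: perp m) (c - p).
  by rewrite -/m dotDl dotZl (dotC (perp m)) dot_perp mulr0 addr0.
have [w [ws ew h1 h2]] := supp _ em.
apply: (wedge_bound (dot w m) (dot w (perp m)) (dot m m) s) => //.
- by rewrite mm.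
- by rewrite -ws dot_frame !expr2.
- exact: frame.
- exact: frame.
- by move: ew; rewrite dotDl dotZl !(dotC w).
Qed.

(** With t the oriented angle from [p - c] to [q - c], this is - sin t / (1 - cos t), that is - cot
    (t / 2). *)
Lemma slopeE c p q : dot (q - c) (q - c) = dot (p - c) (p - c) ->
  slope c p q =
  - dot (q - c) (perp (p - c)) / (dot (p - c) (p - c) - dot (p - c) (q - c)).
Proof.
move=> hq; have -> : dot (p - c) (p - c) - dot (p - c) (q - c) = dot (q - p) (q - p) / 2.
  by move: hq; rewrite /dot !mxE; lra.
rewrite invf_div mulrA /slope; congr (_ / _).
by rewrite /dot !mxE /=; ring.
Qed.

(* The cotangent identity for three half arcs adding up to a multiple of [pi]. *)
Lemma slope_sum c p q z :
    p != q -> q != z -> z != p ->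
    dot (q - c) (q - c) = dot (p - c) (p - c) ->
    dot (z - c) (z - c) = dot (p - c) (p - c) ->
  slope c p q * slope c q z + slope c q z * slope c z p + slope c z p * slope c p q = 1.
Proof.
move=> pq qz zp hq hz; have hqz := etrans hz (esym hq).
rewrite (slopeE c p q)// (slopeE c q z)// (slopeE c z p)//.
have far x y : x != y -> dot (y - c) (y - c) = dot (x - c) (x - c) ->
    0 < dot (x - c) (x - c) - dot (x - c) (y - c).
  by move=> /dot_gt0 xy h; move: xy h; rewrite /dot !mxE; lra.
have dpq := far _ _ pq hq; have dqz := far _ _ qz hqz; have dzp := far _ _ zp (esym hz).
have cs := cauchy_schwarz (p - c) (q - c).
(* Up to the factor [Q], the later [x, y] and [u, v] are cosine and sine of the arcs [pq] and [qz].
   [f1] and [f2] are the addition formulas for the total arc; [f3] and [f4] say that the squares add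
   up to [Q * Q]. *)
have f1 := dot_frame (q - c) (z - c) (p - c).
have f2 := dot_frame (q - c) (z - c) (perp (p - c)).
have f3 := dot_frame (p - c) (q - c) (q - c).
have f4 := dot_frame (q - c) (z - c) (z - c).
move: dpq dqz dzp cs f1 f2 f3 f4; rewrite dot_perp_perp hq hz.
have -> : dot (perp (p - c)) (q - c) = dot (q - c) (perp (p - c)) by rewrite dotC.
have -> : dot (p - c) (perp (q - c)) = - dot (q - c) (perp (p - c)).
  by rewrite /dot !mxE /=; ring.
have -> : dot (p - c) (perp (z - c)) = - dot (z - c) (perp (p - c)).
  by rewrite /dot !mxE /=; ring.
rewrite (dotC (q - c) (p - c)) (dotC (q - c) (z - c)).
set Q := dot (p - c) (p - c); set x := dot (p - c) (q - c); set u := dot (z - c) (q - c).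
set y := dot (q - c) (perp _); set v := dot (z - c) (perp (q - c)).
set C := dot (z - c) (perp _); set D := dot (z - c) (p - c).
clearbody Q x u y v C D => dpq dqz dzp cs f1 f2 f3 f4.
have Q0 : 0 < Q by nra.
have DE : D = (u * x - v * y) / Q by rewrite mulrN in f1; rewrite -f1 mulrAC mulfV ?mul1r ?gt_eqF.
have CE : C = (u * y + v * x) / Q by rewrite -f2 mulrAC mulfV ?mul1r ?gt_eqF.
(* The claim cleared of denominators. Multiplied by [Q], it follows from the addition formulas and
   the relations for [y * y] and [v * v]. *)
have G : y * v * (Q - D) - v * C * (Q - x) - C * y * (Q - u) = (Q - x) * (Q - u) * (Q - D).
  apply: (mulfI (lt0r_neq0 Q0)); apply/eqP; rewrite -subr_eq0; apply/eqP.
  have -> : Q * (y * v * (Q - D) - v * C * (Q - x) - C * y * (Q - u)) -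
     Q * ((Q - x) * (Q - u) * (Q - D)) =
    y * v * (Q ^+ 2 - Q * D) - (v * (Q - x) + y * (Q - u)) * (Q * C)
     - (Q - x) * (Q - u) * (Q ^+ 2 - Q * D) by ring.
  rewrite f1 f2.
  transitivity ((y * y - (Q * Q - x * x)) * (v * v - (Q - u) * u)
    + ((Q * Q - x * x) - (Q - x) * x) * (v * v - (Q * Q - u * u))); first by ring.
  have -> : y * y = Q * Q - x * x by lra.
  have -> : v * v = Q * Q - u * u by lra.
  by ring.
have nz := (lt0r_neq0 dpq, lt0r_neq0 dqz, lt0r_neq0 dzp).
transitivity ((y * v * (Q - D) - v * C * (Q - x) - C * y * (Q - u)) /
    ((Q - x) * (Q - u) * (Q - D))); first by field; rewrite !nz.
by rewrite G divff// !mulf_neq0 ?nz.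
Qed.

Lemma three_contacts c p q z (s : R) :
    3 * dot (p - c) (p - c) < s -> p != q -> q != z -> z != p ->
    dot (q - c) (q - c) = dot (p - c) (p - c) ->
    dot (z - c) (z - c) = dot (p - c) (p - c) ->
    (forall x e, (x = p \/ x = q \/ x = z) -> 0 < dot e (c - x) ->
       exists w, [/\ dot w w = s, 0 <= dot e w &
         forall y, (y = p \/ y = q \/ y = z) -> s <= dot (y - (x + w)) (y - (x + w))]) ->
  False.
Proof.
move=> ps pq qz zp hq hz supp.
have Q0 : 0 < dot (p - c) (p - c).
  rewrite lt_neqAle dot_ge0 andbT eq_sym; apply/eqP => pc.
  move: hq; rewrite pc => /dot_eq0/eqP; rewrite subr_eq0 => /eqP qc.
  by move/dot_eq0/eqP : pc; rewrite subr_eq0 => /eqP pc; rewrite pc qc eqxx in pq.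
have xc x : dot (x - c) (x - c) = dot (p - c) (p - c) -> x != c.
  move=> hx; apply/eqP => xc; move: Q0; rewrite -hx xc subrr dot0l.
  by rewrite ltxx.
have on x : (x = p \/ x = q \/ x = z) -> dot (x - c) (x - c) = dot (p - c) (p - c).
  by move=> [->|[->|->]].
have sp x y y' : (x = p \/ x = q \/ x = z) -> (y = p \/ y = q \/ y = z) ->
    (y' = p \/ y' = q \/ y' = z) -> y != x -> y' != x ->
    3 * (slope c x y - slope c x y') ^+ 2 < 4 + (slope c x y + slope c x y') ^+ 2.
  move=> hx hy hy' yx y'x; apply: (angle_bound _ _ _ _ s) => //.
  - by rewrite on.
  - exact/xc/on.
  - by rewrite !on.
  - by rewrite !on.
  - by move=> e /(supp _ _ hx)[w [ws ew hw]]; exists w; split => //; exact: hw.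
(* With [slope_sum], the three bounds add up to [X^2 + Y^2 + Z^2 < XY + YZ + ZX]. *)
have h1 := sp p q z ltac:(tauto) ltac:(tauto) ltac:(tauto) ltac:(by rewrite eq_sym) zp.
have h2 := sp q z p ltac:(tauto) ltac:(tauto) ltac:(tauto) ltac:(by rewrite eq_sym) pq.
have h3 := sp z p q ltac:(tauto) ltac:(tauto) ltac:(tauto) ltac:(by rewrite eq_sym) qz.
have := slope_sum c p q z pq qz zp hq hz.
move: h1 h2 h3; rewrite (slopeC c z p) (slopeC c p q) (slopeC c q z).
set X := slope c p q; set Y := slope c q z; set Z := slope c z p.
by have := sqr_ge0 (X - Y); have := sqr_ge0 (Y - Z); have := sqr_ge0 (Z - X); nra.
Qed.

(** * Tangential contact *)

Lemma le_normr_sqr (a b : R) : 0 <= b -> a ^+ 2 <= b ^+ 2 -> `|a| <= b.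
Proof.
by move=> b0 ab; rewrite ler_norml lerNl; apply/andP; split; apply: sqr_bound;
  rewrite ?sqrrN.
Qed.

(* The last hypothesis says that points outside [S] approach [p] tangentially to
   the disk of center [c]. If the inner tangent disk of radius [r] were not in [S],
   then [supporting_disk] for [e] close to both tangent directions would give
   [r]-disks covering both tangent directions at [p]. *)
Lemma tangent_disk S r c p n (d : R) :
    closed S -> 0 < r -> disk_condition r S -> closure (~` S) p ->
    0 < d -> dot (p - c) (p - c) = d ^+ 2 -> odisk c (d ^+ 2) `<=` S ->
    (forall U, nbhs p U -> forall k, 0 < k -> exists z, [/\ U z, ~ S z &
       exists2 j, 0 <= j <= k &
         dot (z - p) (z - p) <= 2 * dot (z - p) (c - p) + 2 * (j * dot n (z - p))]) ->
  odisk (p + (r / d) *: (c - p)) (r ^+ 2) `<=` S.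
Proof.
move=> cS r0 dS cp d0 pcd sub bad.
pose m := c - p.
have mm : dot m m = d ^+ 2 by rewrite -dotNN opprB.
have Sp : S p by apply: (odisk_sub_closed _ c (d ^+ 2)) => //; rewrite ?exprn_gt0// pcd.
have supp k : exists w, [/\ dot w w = r ^+ 2, odisk (p + w) (r ^+ 2) `<=` S &
    0 <= dot m w + k * dot (perp m) w].
  have em : 0 < dot (m + k *: perp m) (c - p).
    by rewrite -/m dotDl dotZl (dotC (perp m)) dot_perp mulr0 addr0 mm exprn_gt0.
  rewrite -pcd in sub; have [w [w1 w2 w3]] := supporting_disk _ _ _ _ _ cS r0 dS cp sub em.
  by exists w; split => //; move: w3; rewrite dotDl dotZl.
have out z : ~ S z -> 2 * dot (z - p) m <= dot (z - p) (z - p).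
  move=> Sz; have : d ^+ 2 <= dot (z - c) (z - c) by rewrite leNgt; apply/negP => /sub.
  by rewrite -mm /m /dot !mxE; lra.
have outw w z : dot w w = r ^+ 2 -> odisk (p + w) (r ^+ 2) `<=` S -> ~ S z ->
    2 * dot (z - p) w <= dot (z - p) (z - p).
  move=> ww wS Sz; have : r ^+ 2 <= dot (z - (p + w)) (z - (p + w)).
    by rewrite leNgt; apply/negP => /wS.
  by rewrite -ww /dot !mxE; lra.
rewrite -/m in bad *; clearbody m; clear sub pcd.
have wJ w : dot w w = r ^+ 2 -> dot w m ^+ 2 + dot w (perp m) ^+ 2 = (r * d) ^+ 2.
  by move=> ww; rewrite !expr2 -dot_frame mm ww; ring.
(* Either one of the disks for [L] and [- L] serves, or the two lean strictly to opposite sides and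
   cover both tangent directions; the points given by [bad] exclude the latter. *)
have near_m (L : R) : exists w, [/\ dot w w = r ^+ 2,
    odisk (p + w) (r ^+ 2) `<=` S & L * `|dot w (perp m)| <= dot w m].
  have [w [w1 w2 w3]] := supp L.
  have [w' [w1' w2' w3']] := supp (- L).
  rewrite dotC (dotC (perp m)) in w3; rewrite dotC (dotC (perp m)) in w3'.
  have [a0|a0] := leP (dot w (perp m)) 0.
    by exists w; split => //; rewrite ler0_norm//; lra.
  have [b0|b0] := leP 0 (dot w' (perp m)).
    by exists w'; split => //; rewrite ger0_norm//; lra.
  exfalso.
  pose a := Num.min (dot w (perp m)) (- dot w' (perp m)).
  have ha : 0 < a by rewrite lt_min a0 oppr_gt0.
  have n0 := dot_ge0 n.
  have [k [k0 k1 kb]] := small_factor (Num.min (d / 2) (a / 4))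
    ((1 + dot n n) * (1 + r) + d) ltac:(by rewrite lt_min !divr_gt0) ltac:(nra).
  have {kb} [kd ka] : k * ((1 + dot n n) * (1 + r) + d) <= d / 2 /\
      k * ((1 + dot n n) * (1 + r) + d) <= a / 4.
    by split; apply: (le_trans kb); rewrite ge_min lexx ?orbT.
  have Up : nbhs p (odisk p (k ^+ 2)).
    by apply: odisk_nbhs; rewrite /odisk /= subrr dot0l exprn_gt0.
  have [z [/= zk Sz [j /andP[j0 jk] hj]]] := bad _ Up _ k0.
  have v0 : 0 < dot (z - p) (z - p).
    by apply: dot_gt0; apply/eqP => zp; apply: Sz; rewrite zp.
  have vm := out _ Sz; have vw x h1 h2 := outw x _ h1 h2 Sz.
  have nv := cauchy_schwarz n (z - p).
  have frame x := dot_frame m (z - p) x.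
  rewrite /odisk /= in zk; move: (z - p) => v in zk v0 vm vw nv frame hj *.
  pose V := Num.sqrt (dot v v).
  have VE : dot v v = V ^+ 2 by rewrite sqr_sqrtr// ltW.
  have V0 : 0 < V by rewrite sqrtr_gt0.
  have Vk : V < k by rewrite -(ltr_pXn2r (n := 2)) ?nnegrE ?ltW// -VE.
  pose e := k * (1 + dot n n).
  have e0 : 0 <= e by rewrite /e; nra.
  have nV : `|dot n v| <= (1 + dot n n) * V.
    apply: le_normr_sqr; first by rewrite mulr_ge0// ltW//; lra.
    by apply: (le_trans nv); rewrite VE exprMn ler_pM2r ?exprn_gt0//; nra.
  (* [v] is nearly tangent: the disk tangent at [p] bounds [dot v m] above, and [bad] bounds it
     below. *)
  have mV : `|dot v m| <= e * V.
    rewrite ler_norml; apply/andP; split.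
      have : j * dot n v <= k * ((1 + dot n n) * V).
        apply: (@le_trans _ _ (j * ((1 + dot n n) * V))).
          by apply: ler_wpM2l => //; exact: le_trans (ler_norm _) nV.
        by apply: ler_wpM2r => //; rewrite mulr_ge0 ?ltW//; lra.
      by rewrite /e; lra.
    have : V * V <= k * V by apply: ler_wpM2r; exact: ltW.
    have : 0 <= k * V * dot n n by apply: mulr_ge0 => //; apply: mulr_ge0; exact: ltW.
    by rewrite VE in vm; rewrite /e; nra.
  have ed : e <= d / 2 by rewrite /e; nra.
  have JV : d * V / 2 <= `|dot v (perp m)|.
    apply: sqr_bound => //; rewrite real_normK ?num_real//.
    have : d ^+ 2 * V ^+ 2 = dot v m ^+ 2 + dot v (perp m) ^+ 2.
      by rewrite -mm -VE dot_frame !expr2.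
    have : dot v m ^+ 2 <= (d / 2 * V) ^+ 2.
      rewrite -real_normK ?num_real// lerXn2r ?nnegrE ?normr_ge0//; first by nra.
      by apply: (le_trans mV); rewrite ler_pM2r.
    have : 0 <= d ^+ 2 * V ^+ 2 by rewrite mulr_ge0 ?sqr_ge0.
    by rewrite !exprMn !exprVn; lra.
  (* A disk leaning to the side of [v] would contain [z]: the tangential product is of order [V],
     while the radial product and [dot v v] are smaller by a factor of order [k]. *)
  have contra x : dot x x = r ^+ 2 -> odisk (p + x) (r ^+ 2) `<=` S ->
      a <= `|dot x (perp m)| -> 0 <= dot v (perp m) * dot x (perp m) -> False.
    move=> x1 x2 ax sx.
    have xm : `|dot x m| <= r * d.
      apply: le_normr_sqr; first by nra.
      by rewrite -(wJ _ x1) lerDl sqr_ge0.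
    have := vw _ x1 x2; have := frame x; rewrite mm VE => fx Vx.
    have h1 : d * V / 2 * a <= dot v (perp m) * dot x (perp m).
      rewrite -[leRHS]ger0_norm// normrM; apply: ler_pM => //; last exact: ltW.
      by rewrite !mulr_ge0 ?ltW.
    have h2 : - (dot v m * dot x m) <= e * V * (r * d).
      apply: (le_trans (ler_norm _)); rewrite normrN normrM.
      by apply: ler_pM.
    have h3 : d ^+ 2 * (2 * dot v x) <= d ^+ 2 * V ^+ 2 by rewrite ler_pM2l ?exprn_gt0.
    have : d * V * (a / 2) <= d * V * (d * V / 2 + e * r) by nra.
    rewrite ler_pM2l ?mulr_gt0//.
    have : d * V <= d * k by rewrite ler_pM2l// ltW.
    by rewrite /e; nra.
  have [vJ|vJ] := leP 0 (dot v (perp m)).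
    apply: (contra w) => //; last by rewrite mulr_ge0// ltW.
    by rewrite gtr0_norm// ge_min lexx.
  apply: (contra w') => //; last by rewrite mulr_le0// ltW.
  by rewrite ltr0_norm// ge_min lexx orbT.
move=> z; rewrite odisk_translate /odisk /= => hz.
have zd : d * dot (z - p) (z - p) < 2 * r * dot (z - p) m.
  have : dot (z - p) (z - p) < 2 * (r / d * dot (z - p) m).
    move: hz; rewrite (dot_subsub ((r / d) *: m)) !(dotZl, dotZr) mm (dotC m).
    have -> : r / d * (r / d * d ^+ 2) = r ^+ 2 by field; rewrite gt_eqF.
    by lra.
  by rewrite -(ltr_pM2l d0); congr (_ < _); field; rewrite gt_eqF.
pose v := z - p; rewrite -/v in zd.
have vv := dot_ge0 v.
have vm0 : 0 < dot v m by nra.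
(* [zd] is strict; [h] is a tangential deviation of [w] that its slack absorbs. *)
have [h [h0 _ hh]] := small_factor ((2 * r * dot v m - d * dot v v) * d / 4)
  (dot v m + `|dot v (perp m)|) ltac:(by rewrite divr_gt0// mulr_gt0// subr_gt0)
  ltac:(by rewrite addr_ge0// ltW).
(* As [dot w m <= r * d], this factor makes the tangential component of [w] at most [h]. *)
have [w [ww wS wm]] := near_m (r * d / h).
apply: wS; rewrite odisk_translate /odisk /= -/v.
suff : dot v v < 2 * dot v w.
  by rewrite (dot_subsub w) ww (dotC w); lra.
have rd : 0 < r * d by rewrite mulr_gt0.
have := wJ _ ww; rewrite -[dot w (perp m) ^+ 2]real_normK ?num_real// => wJE.
have J0 := normr_ge0 (dot w (perp m)).
have wm0 : 0 <= dot w m by apply: le_trans wm; rewrite mulr_ge0// divr_ge0 ?ltW.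
have wm_le : dot w m <= r * d by apply: sqr_bound; [exact: ltW|nra].
have Jh : `|dot w (perp m)| <= h.
  by move: (le_trans wm wm_le); rewrite mulrAC ler_pdivrMr// ler_pM2l.
have wm_ge : r * d <= dot w m + `|dot w (perp m)|.
  by apply: sqr_bound; [exact: addr_ge0|nra].
have vJ : - (`|dot v (perp m)| * h) <= dot v (perp m) * dot w (perp m).
  rewrite lerNl; apply: (le_trans (ler_norm _)); rewrite normrN normrM.
  by apply: ler_wpM2l.
have : dot v m * (r * d - h) <= dot v m * dot w m by rewrite ler_pM2l//; lra.
rewrite -(ltr_pM2l (exprn_gt0 2 d0)).
have := dot_frame m v w; rewrite mm.
have : 0 < (2 * r * dot v m - d * dot v v) * d by rewrite mulr_gt0// subr_gt0.
by lra.
Qed.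

(** The inner tangent [r]-disk at [p] is larger than the disk of center [c] and has every other
    point of its circle, in particular [q], in its interior. *)
Lemma tangent_two_contacts S r c p q n :
    closed S -> 0 < r -> disk_condition r S ->
    closure (~` S) p -> closure (~` S) q -> q != p -> p != c ->
    dot (q - c) (q - c) = dot (p - c) (p - c) -> dot (p - c) (p - c) < r ^+ 2 ->
    odisk c (dot (p - c) (p - c)) `<=` S ->
    (forall U, nbhs p U -> forall k, 0 < k -> exists z, [/\ U z, ~ S z &
       exists2 j, 0 <= j <= k &
         dot (z - p) (z - p) <= 2 * dot (z - p) (c - p) + 2 * (j * dot n (z - p))]) ->
  False.
Proof.
move=> cS r0 dS cp cq qp pc hq hr sub bad.
pose d := Num.sqrt (dot (p - c) (p - c)).
have d2 : dot (p - c) (p - c) = d ^+ 2 by rewrite sqr_sqrtr ?dot_ge0.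
have d0 : 0 < d by rewrite sqrtr_gt0 dot_gt0.
have dr : d < r by rewrite -(ltr_pXn2r (n := 2)) ?nnegrE ?ltW// -d2.
have := odisk_closure _ _ _ _ (tangent_disk S r c p n d cS r0 dS cp d0 d2
  ltac:(by rewrite -d2) bad) cq.
have -> : q - (p + (r / d) *: (c - p)) = (q - p) - (r / d) *: (c - p).
  by rewrite opprD addrA.
have mm : dot (c - p) (c - p) = d ^+ 2 by rewrite -dotNN opprB.
have qm : 2 * dot (q - p) (c - p) = dot (q - p) (q - p).
  by move: hq; rewrite /dot !mxE; lra.
have q0 := dot_gt0 _ _ qp.
rewrite dot_subsub !(dotZl, dotZr) mm.
have -> : r / d * (r / d * d ^+ 2) = r ^+ 2 by field; rewrite gt_eqF.
have rd : 1 < r / d by rewrite ltr_pdivlMr// mul1r.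
have : 0 < (r / d - 1) * dot (q - p) (q - p) by rewrite mulr_gt0// subr_gt0.
by rewrite -qm; lra.
Qed.

(** * Growing disks in a one-parameter family until contact *)

Lemma pencil S (f l : 'rV[R]_2 -> R) (L M : R) :
    continuous f -> continuous l -> 0 <= L ->
    (forall z, f z < 0 -> S z) ->
    (forall z, f z <= L * l z -> dot z z <= M) ->
  (forall z, f z < L * l z -> S z) \/
  exists k q, [/\ 0 <= k < L, forall z, f z < k * l z -> S z, closure (~` S) q,
    f q = k * l q & forall U, nbhs q U -> forall d, 0 < d -> exists z, [/\ U z, ~ S z &
      exists2 j, 0 <= j <= d & f z <= (k + j) * l z]].
Proof.
move=> cf cl L0 f0 fM.
have [allL|notL] := pselect (forall z, f z < L * l z -> S z); [by left|right].
(* The parameter stops at the supremum of the admissible ones; points violating slightly larger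
   parameters accumulate at the contact point [q]. *)
pose G := [set k : R | 0 <= k <= L /\ forall z, f z < k * l z -> S z].
have G0 : G 0 by split => [|z]; rewrite ?lexx ?mul0r//; exact: f0.
have supG : has_sup G by split; [exists 0|exists L => x [/andP[]]].
pose k := sup G.
have k0 : 0 <= k by apply: ub_le_sup => //; case: supG.
have kL : k <= L by apply: ge_sup => [|x [/andP[]]//]; exists 0.
(* The supremum is admissible: for [l z > 0] the strict inequality already holds at a member of [G]
   close to [k]; otherwise [f z < 0]. *)
have Gk z : f z < k * l z -> S z.
  move=> fz; have [lz|lz] := leP (l z) 0.
    by apply: f0; apply: lt_le_trans fz _; rewrite mulr_ge0_le0.
  have e0 : 0 < k - f z / l z by rewrite subr_gt0 ltr_pdivrMr.
  have [h [_ Gh] hk] := sup_adherent e0 supG.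
  by apply: Gh; rewrite -ltr_pdivrMr//; move: hk; rewrite -/k opprB addrC subrK.
have kltL : k < L.
  rewrite lt_neqAle kL andbT; apply/eqP => kE; apply: notL => z.
  by rewrite -kE; exact: Gk.
pose P (d : R) := [set z | [/\ ~ S z, 0 < l z & exists2 j, 0 <= j <= d &
  k + j <= L /\ f z <= (k + j) * l z]].
have [q hq] : exists q, forall U, nbhs q U -> forall d, 0 < d -> exists z, U z /\ P d z.
  apply: (accumulation_point P M) => [d d' dd z [Sz lz [j /andP[j0 jd] h]]|d d0].
    by split => //; exists j => //; rewrite j0 (le_trans jd).
  pose j := Num.min d (L - k).
  have j0 : 0 < j by rewrite lt_min d0 subr_gt0.
  have jd : j <= d by rewrite ge_min lexx.
  have jL : k + j <= L by rewrite -lerBrDl ge_min lexx orbT.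
  have /existsNP[z /not_implyP[fz Sz]] : ~ forall z, f z < (k + j) * l z -> S z.
    move=> h; have : k + j <= k; last by lra.
    by apply: ub_le_sup => //; [case: supG|split => //; rewrite jL andbT; lra].
  have lz : 0 < l z.
    rewrite ltNge; apply/negP => lz; apply: Sz; apply: f0; apply: (lt_le_trans fz).
    by rewrite mulr_ge0_le0//; lra.
  exists z; split.
    by apply: fM; apply: (le_trans (ltW fz)); rewrite ler_pM2r.
  by split => //; exists j; [rewrite ltW|split => //; exact: ltW].
have cq : closure (~` S) q.
  by move=> U /hq /(_ 1 ltr01)[z [Uz [Sz _ _]]]; exists z.
pose g z := f z - k * l z.
have cg : continuous g by move=> z; exact: (cvgB (cf z) (cvgM (cvg_cst _) (cl z))).
exists k, q; split => //; first by rewrite k0.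
  (* A positive gap contradicts [f z <= (k + j) * l z] at points near [q] with [j] small; a negative
     one puts a neighborhood of [q] in [S]. *)
  apply/eqP; rewrite -subr_eq0 eq_le; apply/andP; split; rewrite leNgt; apply/negP => gq.
    have [d [d0 _ dl]] := small_factor (g q / 2) (`|l q| + 1) ltac:(by rewrite divr_gt0)
      ltac:(by rewrite addr_ge0).
    have U1 : nbhs q [set z | g q / 2 < g z].
      by apply: cts_nbhs_gt => //; rewrite /g in gq *; lra.
    have U2 : nbhs q [set z | l z < `|l q| + 1].
      by apply: cts_nbhs_lt => //; have := ler_norm (l q); lra.
    have [z [[/= gz lz1] [_ lz [j /andP[j0 jd] [_ fz]]]]] := hq _ (filterI U1 U2) d d0.
    have : j * l z <= d * (`|l q| + 1) by apply: ler_pM => //; exact: ltW.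
    by rewrite /g in gz dl *; lra.
  have U : nbhs q [set z | g z < 0] by exact: cts_nbhs_lt.
  have [z [/= gz [Sz _ _]]] := hq _ U 1 ltr01.
  by apply/Sz/Gk; rewrite -subr_lt0.
move=> U Uq d d0; have [z [Uz [Sz _ [j jd [_ fz]]]]] := hq _ Uq d d0.
by exists z; split => //; exists j.
Qed.

(* The circles of the pencil pass through [p] and through its mirror image in
   the line of the centers. *)
Lemma disk_pencil S c p n (L : R) :
    0 <= L -> odisk c (dot (p - c) (p - c)) `<=` S ->
  let ctr k := c + k *: n in
  odisk (ctr L) (dot (p - ctr L) (p - ctr L)) `<=` S \/
  exists k q, [/\ 0 <= k < L, odisk (ctr k) (dot (p - ctr k) (p - ctr k)) `<=` S,
    closure (~` S) q, dot (q - ctr k) (q - ctr k) = dot (p - ctr k) (p - ctr k) &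
    forall U, nbhs q U -> forall d, 0 < d -> exists z, [/\ U z, ~ S z &
      exists2 j, 0 <= j <= d &
        dot (z - ctr k) (z - ctr k) <= dot (p - ctr k) (p - ctr k) + 2 * (j * dot n (z - p))]].
Proof.
move=> L0 sub ctr.
pose f z := dot (z - c) (z - c) - dot (p - c) (p - c).
pose l z := dot (2 *: n) (z - p).
(* The power of [z] with respect to the circle through [p] centered at [ctr k] is affine in [k]. *)
have E k z : f z - k * l z = dot (z - ctr k) (z - ctr k) - dot (p - ctr k) (p - ctr k).
  by rewrite /f /l /ctr /dot !mxE; ring.
have cf : continuous f.
  by move=> z; exact: (cvgB (continuous_normsq c z) (cvg_cst _)).
have cl : continuous l by exact: continuous_dot.
have f0 z : f z < 0 -> S z by rewrite /f subr_lt0; exact: sub.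
have fM z : f z <= L * l z ->
    dot z z <= 2 * dot (p - ctr L) (p - ctr L) + 2 * dot (ctr L) (ctr L).
  rewrite -subr_le0 E => h; have := dot_ge0 (z - 2 *: ctr L).
  by move: h; rewrite (dot_subsub z (ctr L)) (dot_subsub z (2 *: _)) dotZl !dotZr; lra.
have [h|[k [q [kL kS cq fq bad]]]] := pencil S f l L _ cf cl L0 f0 fM.
  by left => z zL; apply: h; rewrite -subr_lt0 E subr_lt0.
right; exists k, q; split => //.
- by move=> z zk; apply: kS; rewrite -subr_lt0 E subr_lt0.
- by apply/eqP; rewrite -subr_eq0 -E fq subrr.
- move=> U Uq d d0; have [z [Uz Sz [j jd fz]]] := bad _ Uq d d0.
  exists z; split => //; exists j => //.
  by have := E k z; rewrite /l dotZl in fz *; lra.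
Qed.

Lemma dot_chord c p z : dot (z - p) (z - p) - 2 * dot (z - p) (c - p) =
  dot (z - c) (z - c) - dot (p - c) (p - c).
Proof. by rewrite /dot !mxE; ring. Qed.

(** The homothety of center [s] and ratio [d / Num.sqrt t], at most 1, maps the closed disk into
    itself by convexity, as [s] belongs to it. *)
Lemma shrink_disk S d s y t :
    closed S -> 0 < d -> d ^+ 2 <= t -> odisk y t `<=` S -> dot (s - y) (s - y) <= t ->
  exists x, dot (s - x) (s - x) <= d ^+ 2 /\
    forall z, dot (z - x) (z - x) <= d ^+ 2 -> S z.
Proof.
move=> cS d0 dt yS st.
have t0 : 0 < t by apply: lt_le_trans dt; exact: exprn_gt0.
pose k := d / Num.sqrt t.
have kt : k ^+ 2 * t = d ^+ 2.
  by rewrite /k expr_div_n sqr_sqrtr ?ltW// divfK// gt_eqF.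
have k0 : 0 < k by rewrite divr_gt0// sqrtr_gt0.
have k1 : k <= 1 by apply: sqr_bound => //; rewrite -(ler_pM2r t0) kt; lra.
clearbody k; exists (s + k *: (y - s)); split.
  have -> : s - (s + k *: (y - s)) = k *: (s - y).
    by apply/rowP => i; rewrite !mxE; ring.
  by rewrite dotZl dotZr; nra.
move=> z zx; apply: (odisk_sub_closed _ y t) => //.
have -> : z - y = (z - (s + k *: (y - s))) + (1 - k) *: (s - y).
  by apply/rowP => i; rewrite !mxE; ring.
move: zx st; move: (z - (s + k *: (y - s))) (s - y) => a b ha hb.
have hab : 2 * k * dot a b <= dot a a + k ^+ 2 * dot b b.
  by have := dot_ge0 (a - k *: b); rewrite dot_subsub dotZl !dotZr; lra.
rewrite -(ler_pM2l k0) dotDl !(dotDr _ _ a) !(dotDr _ _ (_ *: _)) !(dotZl, dotZr) (dotC b a).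
have : (1 - k) * (2 * k * dot a b) <= (1 - k) * (dot a a + k ^+ 2 * dot b b).
  by apply: ler_wpM2l => //; rewrite subr_ge0.
have : k * (1 - k) * dot b b <= k * (1 - k) * t.
  by apply: ler_wpM2l => //; rewrite mulr_ge0 ?subr_ge0// ltW.
by nra.
Qed.

(** * Growing a disk that keeps [s], in three stages *)

Lemma disk_covering S r d s :
    closed S -> 0 < d -> 3 * d ^+ 2 <= r ^+ 2 -> 0 < r -> disk_condition r S -> S s ->
  exists x, dot (s - x) (s - x) <= d ^+ 2 /\
    forall z, dot (z - x) (z - x) <= d ^+ 2 -> S z.
Proof.
move=> cS d0 dr r0 dS Ss.
have dr2 : d ^+ 2 <= r ^+ 2 by nra.
have fin y t := shrink_disk S d s y t cS d0.
have f0 z : dot (z - s) (z - s) < 0 -> S z by have := dot_ge0 (z - s); lra.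
have fM z : dot (z - s) (z - s) <= d ^+ 2 * 1 -> dot z z <= 2 * d ^+ 2 + 2 * dot s s.
  by have := dot_ge0 (z - 2 *: s); rewrite !dot_subsub dotZl !dotZr; lra.
(* First stage: disks concentric around [s], with the squared radius as parameter. *)
have [h|] := pencil S (fun z => dot (z - s) (z - s)) (fun=> 1) (d ^+ 2) _
    (continuous_normsq s) (fun z => cvg_cst _) (sqr_ge0 _) f0 fM.
  apply: (fin s (d ^+ 2)) => //; last by rewrite subrr dot0l sqr_ge0.
  by move=> z zs; apply: h; rewrite mulr1.
move=> [t [p [/andP[t0 td] tS cp]]]; rewrite mulr1 => pt _.
have {}tS : odisk s (dot (p - s) (p - s)) `<=` S.
  by move=> z; rewrite /odisk /= pt => zs; apply: tS; rewrite mulr1.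
rewrite -{}pt {t} in t0 td.
have [ps|ps] := eqVneq p s.
  have [y [ys yS]] := dS s Ss ltac:(by rewrite -ps).
  by apply: (fin y (r ^+ 2)) => //; rewrite -dotNN opprB.
have T0 := dot_gt0 _ _ ps.
set T := dot (p - s) (p - s) in T0 t0 td.
have psk k : dot (p - (s + k *: (s - p))) (p - (s + k *: (s - p))) = (1 + k) ^+ 2 * T.
  by rewrite /T /dot !mxE; ring.
have ssk k : dot (s - (s + k *: (s - p))) (s - (s + k *: (s - p))) = k ^+ 2 * T.
  by rewrite /T /dot !mxE; ring.
have L0 : 0 <= d ^+ 2 / T by rewrite divr_ge0 ?sqr_ge0.
(* Second stage: circles tangent at [p], the center moving from [s] away from [p]. At
   [k = d ^+ 2 / T] the squared radius [(1 + k) ^+ 2 * T] is at least [d ^+ 2]. *)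
have := disk_pencil S s p (s - p) (d ^+ 2 / T) L0 tS.
rewrite /= psk => -[h|].
  apply: (fin _ _ _ h); first last.
    by rewrite ssk ler_pM2r// lerXn2r ?nnegrE//; lra.
  have : d ^+ 2 = d ^+ 2 / T * T by rewrite divfK// gt_eqF.
  by move: L0; move: (d ^+ 2 / T) => L L0 ->; rewrite ler_pM2r//; nra.
move=> [k [q [/andP[k0 _]]]]; rewrite psk => kS cq qk bad.
pose c := s + k *: (s - p).
rewrite -/c in kS qk bad; set Q := (1 + k) ^+ 2 * T in kS qk bad.
have pc : dot (p - c) (p - c) = Q by rewrite psk.
have sc : dot (s - c) (s - c) <= Q by rewrite ssk /Q ler_pM2r// lerXn2r ?nnegrE//; lra.
have Q0 : 0 < Q by rewrite mulr_gt0// exprn_gt0//; lra.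
have [Qd|Qd] := leP (d ^+ 2) Q; first exact: (fin c Q).
have Qr : Q < r ^+ 2 by lra.
have pc' : p != c.
  by apply/eqP => pcE; move: Q0; rewrite -pc pcE subrr dot0l ltxx.
(* Blocked at [p] itself, the disk extends to the inner tangent [r]-disk, which contains [s] because
   [s] is on the segment from [p] to [c] and [g < r]. *)
have [qp|qp] := eqVneq q p.
  pose g := Num.sqrt Q.
  have g2 : Q = g ^+ 2 by rewrite sqr_sqrtr// ltW.
  have g0 : 0 < g by rewrite sqrtr_gt0.
  have gr : g < r by rewrite -(ltr_pXn2r (n := 2)) ?nnegrE ?ltW// -g2.
  apply: (fin (p + (r / g) *: (c - p)) (r ^+ 2)) => //.
    apply: (tangent_disk S r c p (s - p) g) => //; first by rewrite pc.
      by rewrite -g2.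
    move=> U Up e e0; have [z [Uz Sz [j je hz]]] := bad U ltac:(by rewrite qp) e e0.
    exists z; split => //; exists j => //.
    by have := dot_chord c p z; lra.
  have k1 : 0 < 1 + k by lra.
  have sE : s - p = (1 + k)^-1 *: (c - p).
    have -> : c - p = (1 + k) *: (s - p) by apply/rowP => i; rewrite !mxE; ring.
    by rewrite scalerA mulVf ?scale1r// gt_eqF.
  have -> : s - (p + (r / g) *: (c - p)) = ((1 + k)^-1 - r / g) *: (c - p).
    by rewrite opprD addrA sE scalerBl.
  rewrite dotZl dotZr -(opprB p c) dotNN pc g2.
  have -> : ((1 + k)^-1 - r / g) * (((1 + k)^-1 - r / g) * g ^+ 2) = (g / (1 + k) - r) ^+ 2.
    by field; rewrite !gt_eqF.
  have h0 : 0 < g / (1 + k) by rewrite divr_gt0.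
  have h1 : g / (1 + k) <= g by rewrite ler_pdivrMr//; nra.
  by nra.
(* Third stage: moving the center along a normal of the chord [pq] keeps both points on the circle;
   the orientation toward [s] keeps [s] in the disk. *)
have [n [nqp ns nn]] : exists n, [/\ dot n (q - p) = 0, 0 <= dot n (s - p) & 0 < dot n n].
  have nn : 0 < dot (perp (q - p)) (perp (q - p)) by rewrite dot_perp_perp dot_gt0.
  have nq : dot (perp (q - p)) (q - p) = 0 by rewrite dotC dot_perp.
  have [h|h] := leP 0 (dot (perp (q - p)) (s - p)).
    by exists (perp (q - p)).
  by exists (- perp (q - p)); split; rewrite ?dotNN// dotNl ?nq ?oppr0// oppr_ge0 ltW.
pose B := dot n (p - c).
have pn l : dot (p - (c + l *: n)) (p - (c + l *: n)) = Q - 2 * l * B + l ^+ 2 * dot n n.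
  by rewrite -pc /B /dot !mxE; ring.
have sn l : 0 <= l ->
    dot (s - (c + l *: n)) (s - (c + l *: n)) <= dot (p - (c + l *: n)) (p - (c + l *: n)).
  move=> l0; have : 0 <= l * dot n (s - p) by rewrite mulr_ge0.
  by move: sc; rewrite -pc /dot !mxE; lra.
have qn l : dot (q - (c + l *: n)) (q - (c + l *: n)) = dot (p - (c + l *: n)) (p - (c + l *: n)).
  have : l * dot n (q - p) = 0 by rewrite nqp mulr0.
  by move: qk; rewrite -pc /dot !mxE; lra.
(* Large enough for the squared radius at [L] to reach [d ^+ 2], whatever the sign of [B]. *)
pose L := 1 + (2 * `|B| + d ^+ 2) / dot n n.
have LB : 0 <= (2 * `|B| + d ^+ 2) / dot n n.
  apply: divr_ge0; last exact: ltW.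
  by apply: addr_ge0; [exact: mulr_ge0|exact: sqr_ge0].
have L1 : 1 <= L by rewrite lerDl.
have {}L0 : 0 <= L by lra.
have pL : d ^+ 2 <= dot (p - (c + L *: n)) (p - (c + L *: n)).
  have LE : L * dot n n = dot n n + 2 * `|B| + d ^+ 2.
    by rewrite /L mulrDl mul1r divfK ?gt_eqF//; ring.
  have := ler_norm B; move: (`|B|) LE => B' LE BB'.
  have : 0 <= (L - 1) * (dot n n + d ^+ 2 + 2 * (B' - B)).
    apply: mulr_ge0; first by rewrite subr_ge0.
    by have := sqr_ge0 d; lra.
  rewrite pn expr2 -(mulrA L L) LE; lra.
rewrite -pc in kS.
have := disk_pencil S c p n L L0 kS => /= -[h|].
  by apply: (fin _ _ pL h); exact: sn.
move=> [l [z [/andP[l0 _] lS cz zl {}bad]]].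
have {}qn := qn l; have {}sn := sn l l0.
move: (c + l *: n) => a in lS zl bad qn sn.
have [ad|ad] := leP (d ^+ 2) (dot (p - a) (p - a)); first exact: (fin a _ ad lS sn).
have ar : 3 * dot (p - a) (p - a) < r ^+ 2 by lra.
have ar' : dot (p - a) (p - a) < r ^+ 2 by have := dot_ge0 (p - a); lra.
have pa : p != a.
  apply/eqP => pa; move: qn; rewrite pa subrr dot0l => /dot_eq0/eqP; rewrite subr_eq0 -pa.
  by move=> /eqP qpE; rewrite qpE eqxx in qp.
have qa : q != a.
  apply/eqP => qa; move: qn; rewrite qa subrr dot0l => /esym/dot_eq0/eqP.
  by rewrite subr_eq0 (negbTE pa).
(* The new contact [z] is either an old one met tangentially or a third one; both are impossible. *)
exfalso.
have [zp|zp] := eqVneq z p.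
  apply: (tangent_two_contacts S r a p q n) => // U Up e e0.
  have [y [Uy Sy [j je hy]]] := bad U ltac:(by rewrite zp) e e0.
  exists y; split => //; exists j => //.
  by have := dot_chord a p y; lra.
have [zq|zq] := eqVneq z q.
  apply: (tangent_two_contacts S r a q p n) => //; rewrite ?qn// 1?eq_sym// => U Uq e e0.
  have [y [Uy Sy [j je hy]]] := bad U ltac:(by rewrite zq) e e0.
  exists y; split => //; exists j => //.
  have -> : dot n (y - q) = dot n (y - p).
    by rewrite -[RHS]subr0 -nqp -dotNr -dotDr opprB; congr (dot n _);
      apply/rowP => i; rewrite !mxE; ring.
  by have := dot_chord a q y; lra.
apply: (three_contacts a p q z (r ^+ 2)) => //; rewrite 1?eq_sym// => x e hx ex.
have [xS xa] : closure (~` S) x /\ dot (x - a) (x - a) = dot (p - a) (p - a).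
  by case: hx => [->|[->|->]].
have [w [ww wS ew]] := supporting_disk S r a x e cS r0 dS xS ltac:(by rewrite xa) ex.
exists w; split => // y hy; apply: (odisk_closure S) => //.
by case: hy => [->|[->|->]].
Qed.

End InteriorSphere.

Theorem theorem1p4 (R : realType) (S : set 'rV[R]_2) (r : R)
    (S_nonempty : S !=set0) (S_closed : closed S) (r_gt0 : 0 < r)
    (S_sphere : interior_sphere_condition r S) :
  (exists C : set 'rV[R]_2,
      S = \bigcup_(x in C) closed_eball x (r / Num.sqrt 3)) /\
  (forall s, S s ->
      exists x, closed_eball x (r / Num.sqrt 3) s /\
                closed_eball x (r / Num.sqrt 3) `<=` S).
Proof.
have d0 : 0 < r / Num.sqrt 3 by rewrite divr_gt0// sqrtr_gt0.
have d3 : 3 * (r / Num.sqrt 3) ^+ 2 <= r ^+ 2.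
  by rewrite expr_div_n sqr_sqrtr// mulrC divfK.
have eballE x (a : R) z : 0 <= a -> closed_eball x a z = (dot (z - x) (z - x) <= a ^+ 2 : Prop).
  by move=> a0; rewrite /closed_eball /= enorm_le.
have dS : disk_condition r S.
  move=> q Sq cq; have bq : bdry S q.
    split; first exact: subset_closure.
    by move=> /cq [z [nSz Sz]]; exact: nSz.
  have rE x := eballE x r _ (ltW r_gt0); have [x [xS [cx _]]] := S_sphere q bq.
  exists x; split.
    (* [q] is in the closure of the ball, while the points farther than [r] from [x] form an open
       set missing it. *)
    rewrite -dotNN opprB leNgt; apply/negP => h.
    have [z [zx /= zr]] := cx _ (cts_nbhs_gt _ _ _ (continuous_normsq x) h).
    by move: zx; rewrite rE leNgt zr.
  by move=> z zx; apply: xS; rewrite rE; exact: ltW.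
have cover s : S s -> exists x, closed_eball x (r / Num.sqrt 3) s /\
    closed_eball x (r / Num.sqrt 3) `<=` S.
  move=> /(disk_covering S r _ s S_closed d0 d3 r_gt0 dS)[x [sx xS]].
  by exists x; split=> [|z]; rewrite (eballE _ _ _ (ltW d0))//; exact: xS.
split => //; exists [set x | closed_eball x (r / Num.sqrt 3) `<=` S].
apply/seteqP; split => [s /cover[x [sx xS]]|s [x xS sx]]; last exact: xS.
by exists x.
Qed.
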